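(* Let $S$ be an arbitrary semigroup and let $\Omega\subset S\times S$ be a relation satisfying the following three conditions: (i) $\Omega\cap E(a)=\Omega\cap F(a)$ for all $a\in S$; (ii) $b(\Omega\cap E(ab))\subset\Omega$ for all $a,b\in S$; (iii) $(\Omega\cap F(ab))a\subset\Omega$ for all $a,b\in S$. Then the equivalence $\sim_{\Omega}$ on $S$, defined by $a\sim_\Omega b \Longleftrightarrow \Omega\cap E(a)=\Omega\cap E(b)$, is a congruence on $S$.
   Context: For a semigroup $S$ and $a\in S$, put $E(a)=\{(x,y)\in S\times S\mid ax=ay\}$ and $F(a)=\{(x,y)\in S\times S\mid xa=ya\}$. For a binary relation $R\subset S\times S$ and $x\in S$, put $xR=\{(xa,xb)\mid (a,b)\in R\}$ and $Rx=\{(ax,bx)\mid (a,b)\in R\}$. The symbol $\subset$ denotes (not necessarily strict) inclusion. *)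

(* Defs.v *)
From Stdlib Require Import RelationClasses.
From mathcomp Require Import all_boot.
From mathcomp Require Import boolp classical_sets.

Set Implicit Arguments.
Unset Strict Implicit.
Unset Printing Implicit Defensive.

Local Open Scope classical_set_scope.
Local Open Scope group_scope.

(* [semigroupType] would add a choice structure on the carrier; an arbitrary
   semigroup is therefore a [magmaType] together with a proof of
   [associative (@mul S)].  [magmaType] itself assumes nothing but a binary
   operation. *)

Definition eqL (S : magmaType) (a : S) : set (S * S) :=
  [set p | a * p.1 = a * p.2].

Definition eqR (S : magmaType) (a : S) : set (S * S) :=
  [set p | p.1 * a = p.2 * a].

Definition translL (S : magmaType) (x : S) (R : set (S * S)) : set (S * S) :=
  [set (x * p.1, x * p.2) | p in R].

Definition translR (S : magmaType) (R : set (S * S)) (x : S) : set (S * S) :=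
  [set (p.1 * x, p.2 * x) | p in R].

Definition simOmega (S : magmaType) (Omega : set (S * S)) (a b : S) : Prop :=
  Omega `&` eqL a = Omega `&` eqL b.

Record congruence (S : magmaType) (R : S -> S -> Prop) : Prop := Congruence {
  congruence_equiv : Equivalence R;
  congruence_mull : forall c a b : S, R a b -> R (c * a) (c * b);
  congruence_mulr : forall c a b : S, R a b -> R (a * c) (b * c)
}.

(* Main.v *)
Require Import Defs.
From mathcomp Require Import all_boot.
From mathcomp Require Import boolp classical_sets.
Local Open Scope classical_set_scope.
Local Open Scope group_scope.

(** Compatibility with multiplication on one side is a matter of reassociating.
    If [(x, y)] in [Omega] satisfies [(a * c) * x = (a * c) * y], then
    [(c * x, c * y)] is equalized by [a] on the left and, by condition (ii),
    stays in [Omega]; so any [b] equivalent to [a] equalizes it too, that is,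
    [(b * c) * x = (b * c) * y].  This settles multiplication on the right
    ([eqL_mulr]).  Condition (iii) gives the mirror image for the sets [eqR]
    ([eqR_mull]); condition (i) says that [eqL] and [eqR] cut [Omega] in the
    same sets, so the equivalence may equally be read with [eqR], and
    multiplication on the left follows. *)

Lemma eqL_mulr (S : magmaType) (mulA : associative (@mul S))
    (Omega : set (S * S)) (a b c : S) :
  translL c (Omega `&` eqL (a * c)) `<=` Omega ->
  Omega `&` eqL a `<=` Omega `&` eqL b ->
  Omega `&` eqL (a * c) `<=` Omega `&` eqL (b * c).
Proof.
move=> stable sub_ab [x y] [Oxy /= acxy]; split=> //=.
have Ocxy : Omega (c * x, c * y) by apply: stable; exists (x, y).
have /sub_ab [_] : (Omega `&` eqL a) (c * x, c * y).
  by split=> //; rewrite /eqL /= !mulA.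
by rewrite /eqL /= !mulA.
Qed.

Lemma eqR_mull (S : magmaType) (mulA : associative (@mul S))
    (Omega : set (S * S)) (a b c : S) :
  translR (Omega `&` eqR (c * a)) c `<=` Omega ->
  Omega `&` eqR a `<=` Omega `&` eqR b ->
  Omega `&` eqR (c * a) `<=` Omega `&` eqR (c * b).
Proof.
move=> stable sub_ab [x y] [Oxy /= xyca]; split=> //=.
have Oxyc : Omega (x * c, y * c) by apply: stable; exists (x, y).
have /sub_ab [_] : (Omega `&` eqR a) (x * c, y * c).
  by split=> //; rewrite /eqR /= -!mulA.
by rewrite /eqR /= -!mulA.
Qed.

Theorem theorem1 (S : magmaType) (mulA : associative (@mul S))
    (Omega : set (S * S))
    (Omega_EF : forall a : S, Omega `&` eqL a = Omega `&` eqR a)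
    (Omega_E : forall a b : S, translL b (Omega `&` eqL (a * b)) `<=` Omega)
    (Omega_F : forall a b : S, translR (Omega `&` eqR (a * b)) a `<=` Omega) :
  congruence (simOmega Omega).
Proof.
split.
- by split=> [a|a b|a b c]; rewrite /simOmega // => ->.
- move=> c a b; rewrite /simOmega !Omega_EF => ab.
  by apply/seteqP; split; apply: eqR_mull => //; rewrite ab.
- move=> c a b; rewrite /simOmega => ab.
  by apply/seteqP; split; apply: eqL_mulr => //; rewrite ab.
Qed.
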